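(* Assume the following hypothesis (the Conjecture): there is an integer $m_0$ such that for every integer $m\ge m_0$, whenever $\varepsilon_1,\dots,\varepsilon_{24}\in\{1,-1\}$ and positive integers $x_1,\dots,x_{24}$ satisfy $$\varepsilon_1 x_1^m + \varepsilon_2 x_2^m + \cdots + \varepsilon_{24} x_{24}^m = 0,$$ the solution is trivial. Then there exist an absolute constant $c>0$, an absolute constant $C>0$ and an integer $n_0$ such that for every $n\ge n_0$ and every set $S$ of $n$ positive integers, $$|S.S| < n^{1+c} \quad\Longrightarrow\quad |S+S| \ge C n^2 .$$
   Context: For a finite set $S$ of integers, $S.S := \{st : s,t\in S\}$ and $S+S := \{s+t : s,t\in S\}$. A solution $(\varepsilon_i,x_i)_{1\le i\le 24}$ of the displayed equation is called trivial if the indices $1,\dots,24$ can be partitioned into pairs $\{i,j\}$ such that $x_i=x_j$ and $\varepsilon_i=-\varepsilon_j$ for each pair (i.e. each term $\varepsilon_i x_i^m$ is paired with its negative). *)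

(* Defs.v *)
From mathcomp Require Import all_boot all_order all_algebra.
From mathcomp Require Import finmap.
From mathcomp Require Import reals exp.

Set Implicit Arguments.
Unset Strict Implicit.
Unset Printing Implicit Defensive.

Import Order.TTheory GRing.Theory Num.Theory.

Local Open Scope fset_scope.
Local Open Scope ring_scope.

Definition productset (S : {fset int}) : {fset int} :=
  [fset (s * t)%R | s : int in S, t : int in S].

Definition sumset (S : {fset int}) : {fset int} :=
  [fset (s + t)%R | s : int in S, t : int in S].

Definition is_solution (k m : nat) (eps x : 'I_k -> int) : Prop :=
  [/\ forall i, eps i = 1 \/ eps i = -1,
      forall i, 0 < x i
    & \sum_(i < k) eps i * x i ^+ m = 0].

Definition trivial_solution (k : nat) (eps x : 'I_k -> int) : Prop :=
  exists2 P : {set {set 'I_k}}, partition P [set: 'I_k] &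
    forall B : {set 'I_k}, B \in P ->
      exists i j : 'I_k,
        [/\ i != j, B = [set i; j]%SET, x i = x j & eps i = - eps j].

(* The exponent is a natural number: the threshold m0 may always be raised, so
   letting m0 and m range over all of int would give an equivalent statement. *)
Definition power_sum_conjecture : Prop :=
  exists m0 : nat, forall m : nat, (m0 <= m)%N ->
    forall eps x : 'I_24 -> int,
      is_solution m eps x -> trivial_solution eps x.

(* Main.v *)
(* If |S.S| < n^(1+c), the Plünnecke-Petridis inequality bounds |S.{t^m}|, and
   Ruzsa covering then puts S into few classes modulo m-th powers of rationals.
   A solution of s_1 + s_2 = s_3 + s_4 with s_j = y_j w_j^m in prescribed classes
   is a row (w_1^m, ..., w_4^m) orthogonal to (y_1, y_2, -y_3, -y_4), so any four
   such rows have determinant zero. That determinant is a signed sum of 24 m-th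
   powers, so the conjecture makes the diagonal product equal to another product
   of the expansion. Picking rows greedily to avoid this shows that, up to a
   constant, at most as many solutions exist as share one ratio w_i : w_j; such
   solutions satisfy a three-term equation, where the same argument with 3 x 3
   determinants leaves O(n) of them. Hence the additive energy is O(n^2). *)
Require Import Defs.
From mathcomp Require Import all_boot all_order all_algebra all_fingroup.
From mathcomp Require Import finmap.
From mathcomp Require Import reals exp.
From mathcomp Require Import ring zify.

Set Implicit Arguments.
Unset Strict Implicit.
Unset Printing Implicit Defensive.

Import Order.TTheory GRing.Theory Num.Theory.

Local Open Scope fset_scope.
Local Open Scope ring_scope.

(** * Rows of m-th powers with vanishing determinant *)

Definition conjecture_at (m : nat) : Prop :=
  forall eps x : 'I_24 -> int, is_solution m eps x -> trivial_solution eps x.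

Lemma trivial_solution_partner k (eps x : 'I_k -> int) (i : 'I_k) :
  trivial_solution eps x -> exists j, x i = x j /\ eps i = - eps j.
Proof.
case=> P partP pairs.
have iP : i \in cover P by rewrite (cover_partition partP) inE.
have /pairs [a [b [_ defB xab eab]]] := pblock_mem iP.
have : i \in pblock P i by rewrite mem_pblock.
rewrite defB !inE => /orP[] /eqP ->; first by exists b.
by exists a; rewrite eab opprK.
Qed.

(** The conjecture is applied in this form: one chosen term has a partner. An arbitrary index type
    with 24 elements allows terms indexed by permutations. *)
Lemma conjecture_partner m (I : finType) (eps x : I -> int) (i : I) :
  conjecture_at m -> #|I| = 24 ->
  (forall i, eps i = 1 \/ eps i = -1) -> (forall i, 0 < x i) ->
  \sum_i eps i * x i ^+ m = 0 ->
  exists j, x i = x j /\ eps i = - eps j.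
Proof.
move=> conjm cardI eps1 x_gt0 sum0.
pose f (a : 'I_24) : I := enum_val (cast_ord (esym cardI) a).
pose g (j : I) : 'I_24 := cast_ord cardI (enum_rank j).
have gK : cancel g f by move=> j; rewrite /f /g cast_ordK enum_rankK.
have fK : cancel f g by move=> a; rewrite /f /g enum_valK cast_ordKV.
have sol : is_solution m (eps \o f) (x \o f).
  split=> [a|a|] /=; [exact: eps1 | exact: x_gt0 |].
  by rewrite -[RHS]sum0 [RHS](reindex f) //; apply: onW_bij; exists g.
have [j /=] := trivial_solution_partner (g i) (conjm _ _ sol).
by rewrite gK; exists (f j).
Qed.

(** The nonzero vector [g] lies in the kernel of the matrix of m-th powers, so the determinant
    vanishes. In its Leibniz expansion the identity term has sign 1, hence its partner belongs to an
    odd permutation. *)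
Lemma singular_odd_perm m k r (w : 'I_k -> 'I_k -> int) (g : 'I_k -> int) j0 :
  conjecture_at m -> (k`! * r = 24)%N -> (forall i j, 0 < w i j) ->
  g j0 != 0 -> (forall i, \sum_j g j * w i j ^+ m = 0) ->
  exists2 s : 'S_k, odd_perm s & \prod_i w i i = \prod_i w i (s i).
Proof.
move=> conjm card24 w_gt0 g0 orth.
pose W := \matrix_(i, j) (w i j ^+ m).
pose G := \col_j g j.
have WG : W *m G = 0.
  apply/matrixP => i j; rewrite !mxE -[RHS](orth i).
  by apply: eq_bigr => l _; rewrite !mxE mulrC.
have detW : \det W = 0.
  have /matrixP/(_ j0 0) : \adj W *m W *m G = 0 by rewrite -mulmxA WG mulmx0.
  rewrite mul_adj_mx mul_scalar_mx !mxE => /eqP.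
  by rewrite mulf_eq0 (negPf g0) orbF => /eqP.
have r_gt0 : (0 < r)%N by case: r card24 => //; rewrite muln0.
(* [r] copies of the Leibniz expansion supply exactly 24 terms. *)
pose eps (u : 'S_k * 'I_r) : int := (-1) ^+ odd_perm u.1.
pose x (u : 'S_k * 'I_r) := \prod_i w i (u.1 i).
have [||||[s a] [/= xs eps_s]] :=
    @conjecture_partner m _ eps x (1%g, Ordinal r_gt0) conjm.
- by rewrite card_prod card_Sn card_ord.
- by move=> u; rewrite /eps; case: (odd_perm _); [right | left].
- by move=> u; apply: prodr_gt0.
- rewrite -(pair_bigA _ (fun s a => eps (s, a) * x (s, a) ^+ m)) /=.
  rewrite exchange_big big1 // => a _; rewrite -[RHS]detW.
  apply: eq_bigr => s _; rewrite /eps /x /= -prodrXl; congr (_ * _).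
  by apply: eq_bigr => i _; rewrite mxE.
exists s.
  by move: eps_s; rewrite /eps /= odd_perm1; case: (odd_perm s).
by move: xs; rewrite /x /= => <-; apply: eq_bigr => i _; rewrite perm1.
Qed.

(** Rows are fixed one at a time. After [t] rows only permutations fixing every index from [t] on
    are controlled; each of the at most k! permutations moving [t] spoils at most [L] choices of the
    next row, so a good row remains. *)
Lemma greedy_rows (V : finType) k (F : {set V}) (w : V -> 'I_k -> int) L :
  (forall v i, 0 < w v i) ->
  (forall i j (A B : int), i != j -> 0 < A -> 0 < B ->
     (#|[set v in F | (w v i * A == w v j * B)%R]| <= L)%N) ->
  (k`! * L < #|F|)%N ->
  exists2 rho : 'I_k -> V, forall i, rho i \in F &
    forall s : 'S_k, s != 1%g ->
      \prod_i w (rho i) i != \prod_i w (rho i) (s i).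
Proof.
move=> w_gt0 fibre bigF.
suff : forall t, (t <= k)%N -> exists2 rho : 'I_k -> V, forall i, rho i \in F &
    forall s : 'S_k, s != 1%g -> (forall i : 'I_k, (t <= i)%N -> s i = i) ->
      \prod_i w (rho i) i != \prod_i w (rho i) (s i).
  case/(_ k (leqnn k)) => rho rhoF rhoP; exists rho => // s s1.
  by apply: rhoP => // i; rewrite leqNgt ltn_ord.
(* For a permutation moving [t], equality of the two products prescribes the ratio
   of the entries [t] and [s t] of row [t] in terms of the earlier rows. *)
elim=> [|t IH] tk.
  have /card_gt0P [v vF] : (0 < #|F|)%N by apply: leq_ltn_trans bigF.
  exists (fun=> v) => // s /eqP s1 sid; case: s1.
  by apply/permP => i; rewrite perm1 sid.
have [rho rhoF rhoP] := IH (ltnW tk).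
pose t' := Ordinal tk.
pose A := \prod_(i | i != t') w (rho i) i.
pose B (s : 'S_k) := \prod_(i | i != t') w (rho i) (s i).
pose bad (s : 'S_k) := [set v in F | w v t' * A == w v (s t') * B s].
have bad_small : (#|\bigcup_(s : 'S_k | s t' != t') bad s| <= k`! * L)%N.
  apply: leq_trans (_ : \sum_(s : 'S_k | s t' != t') #|bad s| <= _)%N.
    elim/big_rec2: _ => [|s n X _ le]; first by rewrite cards0.
    by rewrite (leq_trans (leq_card_setU _ _)) // leq_add2l.
  apply: leq_trans (_ : \sum_(s : 'S_k) L <= _)%N; last first.
    by rewrite sum_nat_const card_Sn.
  rewrite big_mkcond leq_sum // => s _; case: ifP => // st.
  by apply: fibre; rewrite 1?eq_sym // prodr_gt0.
have /subsetPn[v vF vgood] : ~~ (F \subset \bigcup_(s : 'S_k | s t' != t') bad s).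
  by apply/negP => /subset_leq_card; rewrite leqNgt (leq_ltn_trans bad_small).
exists (fun i => if i == t' then v else rho i).
  by move=> i; case: ifP.
move=> s s1 sid; rewrite (bigD1 t') //= [X in _ != X](bigD1 t') //= eqxx.
rewrite [X in _ * X != _](eq_bigr (fun i => w (rho i) i)); last first.
  by move=> i /negPf ->.
rewrite [X in _ != _ * X](eq_bigr (fun i => w (rho i) (s i))); last first.
  by move=> i /negPf ->.
case: (eqVneq (s t') t') => [st | st].
  have/(rhoP s s1) : forall i : 'I_k, (t <= i)%N -> s i = i.
    move=> i; rewrite leq_eqVlt => /orP[/eqP ti | /sid //].
    by have -> : i = t' by apply: val_inj.
  rewrite (bigD1 t') //= [X in _ != X](bigD1 t') //= st.
  by apply: contraNneq => /(mulfI (lt0r_neq0 (w_gt0 _ _))) ->.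
apply: contra vgood => /eqP eqv; apply/bigcupP; exists s => //.
by rewrite inE vF; apply/eqP.
Qed.

(** With more than k! * L solutions, [greedy_rows] yields rows whose diagonal product differs from
    all other products, against [singular_odd_perm]. Fixing the classes [y] turns the linear
    relation among the [e] into one among m-th powers. *)
Lemma card_class_rows m k r (T : finType) (e x w : T -> int) (D : int)
    (y c : 'I_k -> int) j0 (F : {set {ffun 'I_k -> T}}) L :
  conjecture_at m -> (k`! * r = 24)%N -> D != 0 ->
  (forall t, 0 < x t) -> (forall t, 0 < w t) ->
  (forall t, e t * D = x t * w t ^+ m) -> c j0 != 0 ->
  (forall v, v \in F -> forall i, x (v i) = y i) ->
  (forall v, v \in F -> \sum_i c i * e (v i) = 0) ->
  (forall i j (A B : int), i != j -> 0 < A -> 0 < B ->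
     (#|[set v in F | (e (v i) * A == e (v j) * B)%R]| <= L)%N) ->
  (#|F| <= k`! * L)%N.
Proof.
move=> conjm card24 D0 x_gt0 w_gt0 exw c0 Fx Fc fibre.
rewrite leqNgt; apply/negP => bigF.
have /card_gt0P [v0 v0F] : (0 < #|F|)%N by apply: leq_ltn_trans bigF.
have y_gt0 i : 0 < y i by rewrite -(Fx _ v0F).
have [|i j A B ij A0 B0||rho rhoF rhoP] :=
    @greedy_rows _ k F (fun v i => w (v i)) L => //.
  (* Since e * D = y * w ^ m, a prescribed ratio of two [w] prescribes the ratio of the [e]; the
     class representatives enter crosswise. *)
  apply: leq_trans (fibre i j (y j * A ^+ m) (y i * B ^+ m) ij _ _); last 2 first.
  - by rewrite mulr_gt0 // exprn_gt0.
  - by rewrite mulr_gt0 // exprn_gt0.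
  apply/subset_leq_card/subsetP => v; rewrite !inE => /andP[vF /eqP wAB].
  rewrite vF /=; apply/eqP/(mulfI D0); rewrite !mulrA ![D * _]mulrC !exw !(Fx _ vF).
  have -> : y i * w (v i) ^+ m * y j * A ^+ m = y i * y j * (w (v i) * A) ^+ m.
    by rewrite exprMn; ring.
  by rewrite wAB exprMn; ring.
have [||i|s odd_s eq_s] := @singular_odd_perm m k r
    (fun i j => w (rho i j)) (fun j => c j * y j) j0 conjm card24.
- by move=> i j; apply: w_gt0.
- by rewrite mulf_neq0 // gt_eqF.
- have := congr1 ( *%R^~ D) (Fc _ (rhoF i)); rewrite mul0r mulr_suml => {2}<-.
  by apply: eq_bigr => j _; rewrite -!mulrA exw (Fx _ (rhoF i)).
have s1 : s != 1%g by apply: contraTneq odd_s => ->; rewrite odd_perm1.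
by have := rhoP s s1; rewrite eq_s eqxx.
Qed.

(** * Counting solutions of three-term and four-term equations *)

Lemma ord3_cases (i j l p : 'I_3) :
  i != j -> l != i -> l != j -> p != l -> p = i \/ p = j.
Proof.
move=> ij li lj pl; apply/pred2P; move: ij li lj pl.
by case: i => [[|[|[|i]]] ?] //; case: j => [[|[|[|j]]] ?] //;
  case: l => [[|[|[|l]]] ?] //; case: p => [[|[|[|p]]] ?].
Qed.

(** If two entries have a prescribed ratio, one determines the other and the equation determines the
    third, so a fibre has at most #|T| elements; the factor 6 is 3!. *)
Lemma card_three_terms m (T : finType) (e x w : T -> int) (D : int)
    (y c : 'I_3 -> int) (F : {set {ffun 'I_3 -> T}}) :
  conjecture_at m -> D != 0 -> injective e ->
  (forall t, 0 < x t) -> (forall t, 0 < w t) ->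
  (forall t, e t * D = x t * w t ^+ m) -> (forall i, c i != 0) ->
  (forall v, v \in F -> forall i, x (v i) = y i) ->
  (forall v, v \in F -> \sum_i c i * e (v i) = 0) ->
  (#|F| <= 6 * #|T|)%N.
Proof.
move=> conjm D0 e_inj x_gt0 w_gt0 exw c0 Fx Fc.
apply: (@card_class_rows m 3 4 T e x w D y c ord0 F #|T|) => //.
move=> i j A B ij A0 B0.
apply: (@leq_card_in _ _ (fun v : {ffun 'I_3 -> T} => v i)) => v v'.
rewrite !inE => /andP[vF /eqP vAB] /andP[vF' /eqP vAB'] eqi.
have eqj : v j = v' j.
  by apply/e_inj/(mulIf (lt0r_neq0 B0)); rewrite -vAB -vAB' eqi.
apply/ffunP => l.
have [->//|li] := eqVneq l i; have [->//|lj] := eqVneq l j.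
apply/e_inj/(mulfI (c0 l)).
have := etrans (Fc _ vF) (esym (Fc _ vF')); rewrite (bigD1 l) //= [in RHS](bigD1 l) //=.
rewrite [X in _ + X = _](eq_bigr (fun p => c p * e (v' p))); last first.
  by move=> p /(ord3_cases ij li lj) [] ->; rewrite ?eqi ?eqj.
by move/addIr.
Qed.

Definition quadruple_sign (i : 'I_4) : int := if (i < 2)%N then 1 else -1.

Definition no_cancellation (T : finType) (v : {ffun 'I_4 -> T}) : bool :=
  [forall i, forall j, (quadruple_sign i == - quadruple_sign j) ==> (v i != v j)].

(** With these signs the equation is a + b = c + d; for injective [e], [no_cancellation] discards
    exactly the solutions with {a, b} = {c, d}. *)
Definition nontrivial_quadruples (T : finType) (e : T -> int) :
    {set {ffun 'I_4 -> T}} :=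
  [set v : {ffun 'I_4 -> T} | (\sum_i quadruple_sign i * e (v i) == 0) &&
    no_cancellation v].

(** Prescribing the ratio of two entries merges their terms into one, so [card_three_terms] bounds
    each fibre by 6 * #|T|, and 144 = 4! * 6. *)
Lemma card_four_terms m (T : finType) (e x w : T -> int) (D : int)
    (y : 'I_4 -> int) (F : {set {ffun 'I_4 -> T}}) :
  conjecture_at m -> D != 0 -> injective e ->
  (forall t, 0 < x t) -> (forall t, 0 < w t) ->
  (forall t, e t * D = x t * w t ^+ m) ->
  (forall v, v \in F -> forall i, x (v i) = y i) ->
  F \subset nontrivial_quadruples e ->
  (#|F| <= 144 * #|T|)%N.
Proof.
move=> conjm D0 e_inj x_gt0 w_gt0 exw Fx /subsetP FN.
set c := quadruple_sign.
have Fc v : v \in F -> \sum_i c i * e (v i) = 0.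
  by move=> /FN; rewrite inE => /andP[/eqP].
have c_pm i : c i = 1 \/ c i = -1.
  by rewrite /c /quadruple_sign; case: ifP; [left | right].
have c0 i : c i != 0 by case: (c_pm i) => ->.
rewrite -[144%N]/(4`! * 6)%N -mulnA.
apply: (@card_class_rows m 4 1 T e x w D y c ord0 F) => //.
move=> i j A B ij A0 B0.
(* The merged coefficient vanishes only if [A = B] and the signs are opposite; then the two entries
   agree, which [no_cancellation] forbids. *)
have [/eqP lin0 | lin0] := boolP (c i * B + c j * A == 0).
  rewrite (_ : [set _ in _ | _] = set0) ?cards0 //; apply/setP => v; rewrite !inE.
  apply/negP => /andP[vF /eqP vAB].
  have AB : A = B by case: (c_pm i) lin0 => ->; case: (c_pm j) => ->; lia.
  have cij : c i = - c j by case: (c_pm i) lin0 => ->; case: (c_pm j) => ->; lia.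
  have := FN v vF; rewrite inE => /andP[_ /forallP/(_ i)/forallP/(_ j)].
  rewrite -/c cij eqxx /= => /eqP[]; apply/e_inj.
  by apply: (mulIf (lt0r_neq0 A0)); rewrite vAB AB.
(* Eliminating the [i]-th term leaves a three-term equation. *)
pose c' (l : 'I_3) := if lift i l == j then c i * B + c j * A else A * c (lift i l).
pose red (v : {ffun 'I_4 -> T}) : {ffun 'I_3 -> T} := [ffun l => v (lift i l)].
set G := [set _ in _ | _].
have red_inj : {in G &, injective red}.
  move=> v v'; rewrite !inE => /andP[_ /eqP vAB] /andP[_ /eqP vAB'] eqv.
  have off l : l != i -> v l = v' l.
    case: (unliftP i l) => [l' ->|->]; rewrite ?eqxx // => _.
    by move/ffunP/(_ l'): eqv; rewrite !ffunE.
  apply/ffunP => l; have [->|/off//] := eqVneq l i.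
  apply/e_inj/(mulIf (lt0r_neq0 A0)); rewrite vAB vAB' off // eq_sym.
  by rewrite ij.
rewrite -(card_in_imset red_inj).
apply: (@card_three_terms m T e x w D (fun l => y (lift i l)) c') => //.
- move=> l; rewrite /c'; case: ifP => // _.
  by rewrite mulf_neq0 // lt0r_neq0.
- move=> _ /imsetP[v vG ->] l; move: vG; rewrite inE ffunE => /andP[vF _].
  exact: Fx.
- move=> _ /imsetP[v vG ->]; move: vG; rewrite inE => /andP[vF /eqP vAB].
  have := Fc v vF; rewrite (bigD1_ord i) //=.
  have [j' def_j] : exists j', j = lift i j'.
    by case: (unliftP i j) ij => [j' ->|->]; [exists j' | rewrite eqxx].
  rewrite (bigD1 j') //= -def_j => sum0.
  rewrite (bigD1 j') //= /c' ffunE -def_j eqxx.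
  rewrite (eq_bigr (fun l => A * (c (lift i l) * e (v (lift i l))))); last first.
    by move=> l lj; rewrite ffunE def_j (inj_eq lift_inj) (negPf lj) mulrA.
  rewrite -mulr_sumr; move/(congr1 ( *%R A)): sum0.
  rewrite mulr0 !mulrDr addrA => {2}<-; congr (_ + _).
  by rewrite [A * (c i * _)]mulrCA [A * e _]mulrC vAB; ring.
Qed.

Lemma card_nontrivial_quadruples m (T Y : finType) (e w : T -> int) (D : int)
    (kappa : T -> Y) (xi : Y -> int) :
  conjecture_at m -> D != 0 -> injective e ->
  (forall y, 0 < xi y) -> (forall t, 0 < w t) ->
  (forall t, e t * D = xi (kappa t) * w t ^+ m) ->
  (#|nontrivial_quadruples e| <= #|Y| ^ 4 * (144 * #|T|))%N.
Proof.
move=> conjm D0 e_inj xi_gt0 w_gt0 exw.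
pose cls (v : {ffun 'I_4 -> T}) : {ffun 'I_4 -> Y} := [ffun i => kappa (v i)].
rewrite -sum1_card (partition_big cls predT) //=.
have <- : #|{ffun 'I_4 -> Y}| = (#|Y| ^ 4)%N by rewrite card_ffun card_ord.
rewrite -sum_nat_const.
apply: leq_sum => z _; rewrite sum1dep_card.
apply: (@card_four_terms m T e (xi \o kappa) w D (fun i => xi (z i))) => //=.
- by move=> v; rewrite inE => /andP[_ /eqP <-] i; rewrite ffunE.
- by apply/subsetP => v; rewrite inE => /andP[].
Qed.

(** * Additive energy *)

(** The constants are tuned to [card_sums]: there the trivial collisions number at most 2 * #|T| ^
    2, half of the left-hand side 4 * #|T| ^ 2. *)
Lemma card_collisions (A U : finType) (f : A -> U) :
  (4 * #|A| <= 4 * #|U| + #|[set p : A * A | f p.1 == f p.2]|)%N.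
Proof.
pose r u := #|[set a | f a == u]|.
have -> : #|A| = (\sum_u r u)%N.
  rewrite -sum1_card (partition_big f predT) //.
  by apply: eq_bigr => u _; rewrite sum1dep_card.
have -> : #|[set p : A * A | f p.1 == f p.2]| = (\sum_u r u * r u)%N.
  rewrite -sum1_card (partition_big (fun p => f p.2) predT) //.
  apply: eq_bigr => u _; rewrite sum1dep_card -cardsX.
  apply: eq_card => -[a b]; rewrite !inE /=.
  by apply/andP/andP => -[/eqP -> /eqP ->].
rewrite -sum1_card !big_distrr -big_split /=; apply: leq_sum => u _.
(* (r - 2)^2 >= 0 replaces the Cauchy-Schwarz inequality. *)
rewrite muln1; have := sqr_ge0 ((r u)%:Z - 2); rewrite expr2; nia.
Qed.

Lemma card_sums (T U : finType) (e : T -> int) (f : T * T -> U) :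
  injective e ->
  (forall p q, f p = f q -> e p.1 + e p.2 = e q.1 + e q.2) ->
  (2 * #|T| ^ 2 <= 4 * #|U| + #|nontrivial_quadruples e|)%N.
Proof.
move=> e_inj fP; have := card_collisions f; rewrite card_prod mulnn.
set C := [set p | _].
pose quad (u : (T * T) * (T * T)) : {ffun 'I_4 -> T} :=
  [ffun i : 'I_4 => nth u.1.1 [:: u.1.1; u.1.2; u.2.1; u.2.2] i].
have quad_inj : injective quad.
  move=> [[a b] [c d]] [[a' b'] [c' d']] /ffunP eqq.
  move: (eqq (@Ordinal 4 0 isT)) (eqq (@Ordinal 4 1 isT)).
  move: (eqq (@Ordinal 4 2 isT)) (eqq (@Ordinal 4 3 isT)).
  by rewrite !ffunE /= => -> -> -> ->.
have CS : C \subset [set (p, p) | p : T * T] :|: [set (p, (p.2, p.1)) | p : T * T]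
                :|: quad @^-1: nontrivial_quadruples e.
  apply/subsetP => -[[a b] [c d]]; rewrite inE => /eqP/fP /= abcd.
  rewrite !inE; case: (boolP (no_cancellation _)) => [_ | ].
    apply/orP; right; rewrite !big_ord_recr big_ord0 /= !ffunE /=.
    by rewrite andbT /quadruple_sign /=; apply/eqP; lia.
  rewrite !negb_forall => cancels; apply/orP; left.
  (* A cancellation involving [b] gives one involving [a], because [e] is injective and a + b = c +
     d holds for the images. *)
  have : (a == c) || (a == d).
    case/existsP: cancels => i; rewrite negb_forall => /existsP[j].
    rewrite negb_imply negbK !ffunE /=.
    case: i => [[|[|[|[|i]]]] ?] //; case: j => [[|[|[|[|j]]]] ?] //=;
      rewrite /quadruple_sign //= => /eqP eqs; rewrite ?eqs ?eqxx ?orbT //;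
      move: abcd; rewrite ?eqs => abcd; apply/orP;
      (left + right); apply/eqP/e_inj; lia.
  case/orP => /eqP eqa; apply/orP; [left | right]; apply/imsetP; exists (a, b) => //.
    by congr (_, (_, _)) => //; apply: e_inj; move: abcd; rewrite eqa; lia.
  by congr (_, (_, _)) => //=; apply: e_inj; move: abcd; rewrite eqa; lia.
have := subset_leq_card CS.
set X1 := [set (p, p) | p : _]; set X2 := [set (p, _) | p : _].
have X1n : (#|X1| <= #|T| ^ 2)%N.
  by rewrite (leq_trans (leq_imset_card _ _)) ?card_prod ?mulnn.
have X2n : (#|X2| <= #|T| ^ 2)%N.
  by rewrite (leq_trans (leq_imset_card _ _)) ?card_prod ?mulnn.
have [+ _] := leq_card_setU (X1 :|: X2) (quad @^-1: nontrivial_quadruples e).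
have [+ _] := leq_card_setU X1 X2.
have : (#|quad @^-1: nontrivial_quadruples e| <= #|nontrivial_quadruples e|)%N.
  rewrite -(card_imset _ quad_inj); apply/subset_leq_card/subsetP => _ /imsetP[u uN ->].
  by move: uN; rewrite inE.
lia.
Qed.

(** * Products of finite sets of integers *)

Definition prodset (A B : {fset int}) : {fset int} :=
  [fset (a * b)%R | a : int in A, b : int in B].

Lemma mem_prodset (A B : {fset int}) a b :
  a \in A -> b \in B -> a * b \in prodset A B.
Proof. by move=> aA bB; apply/imfset2P; exists a => //; exists b. Qed.

Lemma prodsetA (A B C : {fset int}) :
  prodset (prodset A B) C = prodset A (prodset B C).
Proof.
apply/fsetP => z; apply/imfset2P/imfset2P => /= -[].
  move=> _ /imfset2P[/= a aA [b bB ->]] [c cC ->].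
  by exists a => //; exists (b * c); rewrite ?mulrA ?mem_prodset.
move=> a aA [_ /imfset2P[/= b bB [c cC ->]] ->].
by exists (a * b); [rewrite mem_prodset | exists c => //; rewrite mulrA].
Qed.

Lemma prodsetU1 (A B : {fset int}) b :
  prodset A (b |` B) = prodset A B `|` [fset (a * b)%R | a in A].
Proof.
apply/fsetP => z; rewrite in_fsetU; apply/imfset2P/orP => /=.
  move=> [a aA [c]]; rewrite !inE => /orP[/eqP -> ->|cB ->].
    by right; apply: (in_imfset _ (fun a : int => a * b)).
  by left; apply: mem_prodset.
case=> [/imfset2P[/= a aA [c cB ->]]|/imfsetP[/= a aA ->]].
  by exists a => //; exists c; rewrite // !inE cB orbT.
by exists a => //; exists b; rewrite // !inE eqxx.
Qed.

Lemma card_fset_mulr (A : {fset int}) b :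
  b != 0 -> #|` [fset (a * b)%R | a in A]| = #|` A|.
Proof. by move=> b0; rewrite card_imfset //; apply: mulIf. Qed.

(* The hypothesis says that [X] minimizes |QS| / |Q| among the subsets [Q] of [X]. *)
Lemma petridis (X S Z : {fset int}) :
  (forall Q : {fset int}, Q `<=` X ->
    (#|` prodset X S| * #|` Q| <= #|` prodset Q S| * #|` X|)%N) ->
  (forall z, z \in Z -> z != 0) ->
  (#|` prodset (prodset X S) Z| * #|` X| <= #|` prodset X S| * #|` prodset X Z|)%N.
Proof.
move=> minX; elim/fset1U_rect: Z => [|z Z zZ IH] Z0.
  have -> : prodset (prodset X S) fset0 = fset0.
    by apply/eqP/fset0Pn => -[u /imfset2P[/= a _ [b]]]; rewrite inE.
  by rewrite cardfs0.
have z0 : z != 0 by apply: Z0; rewrite !inE eqxx.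
have {}IH := IH (fun y yZ => Z0 y (fsubsetP (fsubsetUr _ _) y yZ)).
(* Adjoining [z] adds at least |X| - |Q| elements to X.Z and at most |X.S| - |Q.S| to X.S.Z;
   minimality of [X], applied to [Q], compares the two increments. *)
pose Q := [fset x in X | x * z \in prodset X Z].
have QX : Q `<=` X by apply/fsubsetP => x; rewrite !inE => /andP[].
have capQ : (#|` prodset X Z `&` [fset (a * z)%R | a in X]| <= #|` Q|)%N.
  rewrite -(card_fset_mulr Q z0); apply/fsubset_leq_card/fsubsetP => u.
  rewrite in_fsetI => /andP[uXZ /imfsetP[/= a aX def_u]]; rewrite def_u in uXZ *.
  by apply: (in_imfset _ (fun a : int => a * z)); rewrite /= !inE aX.
have capQS : (#|` prodset Q S| <=
    #|` prodset (prodset X S) Z `&` [fset (a * z)%R | a in prodset X S]|)%N.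
  rewrite -(card_fset_mulr (prodset Q S) z0); apply/fsubset_leq_card/fsubsetP => u.
  case/imfsetP => /= _ /imfset2P[/= a aQ [s sS ->]] ->.
  have [aX /imfset2P[/= x xX [y yZ eqaz]]] : a \in X /\ a * z \in prodset X Z.
    by move: aQ; rewrite !inE => /andP.
  rewrite in_fsetI; apply/andP; split; last first.
    by apply: (in_imfset _ (fun a : int => a * z)); apply: mem_prodset.
  by rewrite mulrAC eqaz mulrAC !mem_prodset.
have := cardfsUI (prodset X Z) [fset (a * z)%R | a in X].
have := cardfsUI (prodset (prodset X S) Z) [fset (a * z)%R | a in prodset X S].
rewrite -!prodsetU1 !(card_fset_mulr _ z0).
have := minX Q QX; nia.
Qed.

Lemma min_expansion (S : {fset int}) : S != fset0 ->
  exists X : {fset int}, [/\ X `<=` S, X != fset0 &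
    forall Q : {fset int}, Q `<=` S ->
      (#|` prodset X S| * #|` Q| <= #|` prodset Q S| * #|` X|)%N].
Proof.
move=> S0; pose ratio (X : {fset int}) : rat := #|` prodset X S|%:R / #|` X|%:R.
have SP : S \in fpowerset S by rewrite fpowersetE.
case: (@arg_minP _ _ _ [` SP] (fun X => val X != fset0) (fun X => ratio (val X)) S0).
case=> X /= XP X0 minX; exists X; split=> //; first by rewrite -fpowersetE.
move=> Q QS; have [->|Q0] := eqVneq Q fset0; first by rewrite cardfs0 muln0.
have QP : Q \in fpowerset S by rewrite fpowersetE.
have := minX [` QP] Q0; rewrite /ratio /= -(ler_nat rat) !natrM.
by rewrite ler_pdivrMr ?ltr0n ?cardfs_gt0 // mulrAC ler_pdivlMr ?ltr0n ?cardfs_gt0.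
Qed.

Fixpoint powset (S : {fset int}) k : {fset int} :=
  if k is k'.+1 then prodset S (powset S k') else [fset 1].

(** This is how m-th powers enter: the dilates of {t^m} by [S] lie in an iterated product set, whose
    size [plunnecke] controls. *)
Lemma mem_powset (S : {fset int}) k s t :
  s \in S -> t \in S -> s * t ^+ k \in powset S k.+1.
Proof.
move=> sS tS; elim: k => [|k IH] /=.
  by rewrite expr0; apply: mem_prodset; rewrite // inE.
by rewrite exprS mulrCA; apply: mem_prodset.
Qed.

Lemma powset_gt0 (S : {fset int}) k :
  (forall s, s \in S -> 0 < s) -> forall s, s \in powset S k -> 0 < s.
Proof.
move=> S_gt0; elim: k => [|k IH] s /=; first by rewrite inE => /eqP ->.
by case/imfset2P => /= a aS [b bS ->]; apply: mulr_gt0; [apply: S_gt0 | apply: IH].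
Qed.

(** One minimizer [X] of the expansion ratio serves for all [k]: by [petridis] each further factor
    [S] costs at most |X.S| / |X|, and comparing [X] with [S] bounds this by |S.S| / |S|. *)
Lemma plunnecke (S : {fset int}) k : S != fset0 -> (forall s, s \in S -> 0 < s) ->
  exists X : {fset int}, [/\ X `<=` S, X != fset0 &
    (#|` prodset X (powset S k)| * #|` S| ^ k <= #|` prodset S S| ^ k * #|` X|)%N].
Proof.
move=> S0 S_gt0; have [X [XS X0 minX]] := min_expansion S0.
exists X; split=> //; elim: k => [|k IH] /=.
  rewrite expn0 !mul1n muln1 -(card_fset_mulr X (oner_neq0 _)).
  apply/fsubset_leq_card/fsubsetP => u /imfset2P[/= a aX [b]].
  by rewrite inE => /eqP -> ->; apply: (in_imfset _ (fun a : int => a * 1)).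
have X_gt0 : (0 < #|` X|)%N by rewrite cardfs_gt0.
have := @petridis X S (powset S k) (fun Q QX => minX Q (fsubset_trans QX XS))
  (fun z zS => lt0r_neq0 (powset_gt0 S_gt0 zS)).
rewrite prodsetA => le1; rewrite -(leq_pmul2r X_gt0) !expnS.
have le2 := minX S (fsubset_refl _).
rewrite mulnAC; apply: leq_trans (leq_mul le1 (leqnn _)) _.
rewrite mulnACA; apply: leq_trans (leq_mul le2 IH) _.
by rewrite mulnACA mulnA.
Qed.

(** * Covering by classes modulo m-th powers *)

(** Take [Y] maximal with disjoint dilates. Disjointness bounds |Y| through [plunnecke]; maximality
    makes the dilate by any [s] meet one of them. *)
Lemma ruzsa_covering (S : {fset int}) m :
  S != fset0 -> (forall s, s \in S -> 0 < s) -> (0 < m)%N ->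
  exists2 Y : {set S}, (#|Y| * #|` S| ^ m.+1 <= #|` prodset S S| ^ m.+1)%N &
    forall s : S, exists2 y, y \in Y &
      exists t t' : S, val s * val t' ^+ m = val y * val t ^+ m.
Proof.
move=> S0 S_gt0 m_gt0.
have val_gt0 (s : S) : 0 < val s by apply: S_gt0; apply: valP.
pose disj (Y : {set S}) := [forall y in Y, forall y' in Y, (y != y') ==>
  [forall t : S, forall t' : S, val y * val t ^+ m != val y' * val t' ^+ m]].
have disjP (Y : {set S}) : reflect (forall y y' (t t' : S), y \in Y -> y' \in Y -> y != y' ->
    val y * val t ^+ m != val y' * val t' ^+ m) (disj Y).
  apply: (iffP forall_inP) => [disjY y y' t t' yY y'Y yy'|disjY y yY].
    by have /forall_inP/(_ _ y'Y)/implyP/(_ yy')/forallP/(_ t)/forallP := disjY y yY.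
  apply/forall_inP => y' y'Y; apply/implyP => yy'.
  by apply/forallP => t; apply/forallP => t'; apply: disjY.
(* [disj Y]: the dilates of the set of m-th powers by [Y] are disjoint. *)
have [|Y /maxsetP[/disjP disjY maxY]] := ex_maxset (P := disj).
  by exists finset.set0; apply/disjP => y y' t t'; rewrite inE.
exists Y.
  have [X [XS X0 leX]] := plunnecke m.+1 S0 S_gt0.
  (* Multiplication by one fixed [x0] embeds the pairs (y, t) into the set that [plunnecke]
     bounds. *)
  have /fset0Pn [x0 x0X] := X0.
  have x0_gt0 : 0 < x0 by apply/S_gt0/(fsubsetP XS).
  have X_gt0 : (0 < #|` X|)%N by rewrite cardfs_gt0.
  have XleS : (#|` X| <= #|` S|)%N by apply: fsubset_leq_card.
  have imP (u : S * S) : x0 * (val u.1 * val u.2 ^+ m) \in prodset X (powset S m.+1).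
    by apply: mem_prodset => //; apply: mem_powset; apply: valP.
  have leYS : (#|Y| * #|` S| <= #|` prodset X (powset S m.+1)|)%N.
    rewrite !cardfE -[X in (_ * X)%N]cardsT -cardsX.
    apply: (@leq_card_in _ _ (fun u : S * S => [` imP u])) => // -[y t] [y' t'].
    rewrite !inE !andbT /= => yY y'Y /(congr1 val) /= /(mulfI (lt0r_neq0 x0_gt0)) eqyt.
    have eqy : y = y'.
      by apply: contraTeq isT => yy'; have := disjY _ _ t t' yY y'Y yy'; rewrite eqyt eqxx.
    congr (_, _) => //; apply: val_inj; apply/eqP.
    rewrite -(@eqrXn2 _ m) ?ltW //; apply/eqP.
    by move: eqyt; rewrite eqy => /(mulfI (lt0r_neq0 (val_gt0 _))).
  rewrite -(leq_pmul2r X_gt0); apply: leq_trans leX.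
  rewrite [X in (_ <= X)%N]mulnC [X in (_ <= X)%N]mulnC.
  apply: leq_trans (leq_mul leYS (leqnn _)); rewrite mulnAC leq_mul2r.
  by rewrite leq_mul2l XleS !orbT.
move=> s; pose hit (y : S) := [exists t : S, exists t' : S,
  val s * val t' ^+ m == val y * val t ^+ m].
have [/exists_inP[y yY /existsP[t /existsP[t' /eqP eqs]]]|] := boolP [exists y in Y, hit y].
  by exists y => //; exists t, t'.
rewrite negb_exists_in => /forall_inP miss.
have none (y t t' : S) : y \in Y -> val s * val t' ^+ m != val y * val t ^+ m.
  by move=> /miss; rewrite negb_exists => /forallP/(_ t); rewrite negb_exists => /forallP.
have sY : s \notin Y by apply/negP => /(none _ s s); rewrite eqxx.
suff : s |: Y = Y by move/setP/(_ s); rewrite !inE eqxx (negPf sY).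
apply: maxY; last by apply: subsetUr.
apply/disjP => y y' t t'; rewrite !inE => /predU1P[->|yY] /predU1P[->|y'Y] yy'.
- by rewrite eqxx in yy'.
- exact: none.
- by rewrite eq_sym none.
- exact: disjY.
Qed.

(** The covering gives s = y * (t / t') ^ m. With [P] the product of all elements of [S], the factor
    P ^ m clears every denominator at once; a [D] common to all [s] preserves linear relations. *)
Lemma power_classes (S : {fset int}) m :
  S != fset0 -> (forall s, s \in S -> 0 < s) -> (0 < m)%N ->
  exists (Y : {set S}) (D : int) (kappa : S -> {y | y \in Y}) (w : S -> int),
    [/\ (#|Y| * #|` S| ^ m.+1 <= #|` prodset S S| ^ m.+1)%N, D != 0,
        forall s, 0 < w s &
        forall s, val s * D = val (val (kappa s)) * w s ^+ m].
Proof.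
move=> S0 S_gt0 m_gt0; have [Y leY cover] := ruzsa_covering S0 S_gt0 m_gt0.
have val_gt0 (s : S) : 0 < val s by apply: S_gt0; apply: valP.
pose P := \prod_(t : S) val t.
have P_gt0 : 0 < P by apply: prodr_gt0.
have /fin_all_exists2 [kw kw_gt0 kwP] (s : S) : exists2 u : {y | y \in Y} * int,
    0 < u.2 & val s * P ^+ m = val (val u.1) * u.2 ^+ m.
  have [y yY [t [t' eqs]]] := cover s.
  pose q := \prod_(u : S | u != t') val u.
  have Pq : P = val t' * q by rewrite /P (bigD1 t').
  exists (Sub y yY, val t * q) => /=.
    by apply: mulr_gt0; [apply: val_gt0 | apply: prodr_gt0 => u _; apply: val_gt0].
  by rewrite Pq !exprMn !mulrA eqs.
exists Y, (P ^+ m), (fun s => (kw s).1), (fun s => (kw s).2); split=> //.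
by rewrite expf_neq0 // lt0r_neq0.
Qed.

(** * From few classes to a quadratic sumset *)

(** The smallness hypothesis gives |Y|^5 < |S|. With 144^5 <= |S| this yields 144 * |Y|^4 <= |S|,
    whether or not |Y| exceeds 144, so there are at most |S|^2 nontrivial quadruples. *)
Lemma large_sumset m (S : {fset int}) :
  conjecture_at m -> (0 < m)%N -> (forall s, s \in S -> 0 < s) ->
  (144 ^ 5 <= #|` S|)%N ->
  (#|` prodset S S| ^ (5 * m.+1) < #|` S| ^ (5 * m.+1).+1)%N ->
  (#|` S| ^ 2 <= 4 * #|` sumset S|)%N.
Proof.
move=> conjm m_gt0 S_gt0 bigS small.
have n_gt0 : (0 < #|` S|)%N by apply: leq_trans bigS; rewrite expn_gt0.
have S0 : S != fset0 by rewrite -cardfs_gt0.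
have val_gt0 (s : S) : 0 < val s by apply: S_gt0; apply: valP.
have [Y [D [kappa [w [leY D0 w_gt0 cls]]]]] := power_classes S0 S_gt0 m_gt0.
have leY5 : (#|Y| ^ 5 < #|` S|)%N.
  have pow_gt0 : (0 < #|` S| ^ (5 * m.+1))%N by rewrite expn_gt0 n_gt0.
  rewrite -(ltn_pmul2r pow_gt0) -expnS; apply: leq_ltn_trans small.
  by rewrite [(5 * _)%N]mulnC !expnM -expnMn leq_exp2r.
have leY4 : (144 * #|Y| ^ 4 <= #|` S|)%N.
  have [Ysmall|Ybig] := leqP #|Y| 144.
    by apply: leq_trans bigS; rewrite [X in (_ <= X)%N]expnS leq_mul2l leq_exp2r.
  by apply: leq_trans (ltnW leY5); rewrite expnS leq_mul2r ltnW ?orbT.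
have sumP (p : S * S) : val p.1 + val p.2 \in sumset S.
  by apply/imfset2P; exists (val p.1); rewrite ?(valP p.1) //; exists (val p.2);
    rewrite ?(valP p.2).
have sum_eq p q : [` sumP p] = [` sumP q] ->
    val p.1 + val p.2 = val q.1 + val q.2 by move/(congr1 val).
have := card_sums (e := val) val_inj sum_eq; rewrite -!cardfE.
have := card_nontrivial_quadruples (xi := fun y => val (val y)) conjm D0
  val_inj (fun y => val_gt0 (val y)) w_gt0 cls.
rewrite card_sig -cardfE => leN le2.
have leN' : (#|nontrivial_quadruples (val : S -> int)| <= #|` S| ^ 2)%N.
  apply: leq_trans leN _; rewrite mulnA -mulnn leq_mul2r mulnC.
  by rewrite leY4 orbT.
by move: (leq_trans le2 (leq_add (leqnn _) leN')); rewrite mul2n -addnn leq_add2r.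
Qed.

Theorem theorem2 (R : realType) (conj24 : power_sum_conjecture) :
  exists (c C : R) (n0 : nat), 0 < c /\ 0 < C /\
    forall (n : nat) (S : {fset int}), (n0 <= n)%N ->
      #|` S| = n :> nat -> (forall s, s \in S -> 0 < s) ->
      (#|` productset S|%:R : R) < (n%:R : R) `^ (1 + c) ->
      C * (n%:R : R) ^+ 2 <= (#|` sumset S|%:R : R).
Proof.
(* A successor [m] is positive. The choice c = 1/K gives (n^(1+c))^K = n^(K+1), the bound required
   by [large_sumset], which also supplies C = 1/4 and the threshold. *)
have [m0 conj_m] := conj24; pose m := m0.+1; pose K := (5 * m.+1)%N.
exists (K%:R^-1), (4^-1), (144 ^ 5)%N; split; first by rewrite invr_gt0 ltr0n.
split=> [|n S n_big cardS S_gt0]; first by rewrite invr_gt0.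
rewrite -cardS in n_big * => small.
rewrite mulrC ler_pdivrMr // mulrC -natrX -natrM ler_nat.
apply: (@large_sumset m) => //; first exact: conj_m.
rewrite -(ltr_nat R) !natrX -/K.
have K0 : K%:R != 0 :> R by rewrite pnatr_eq0.
apply: lt_le_trans (_ : (#|` S|%:R `^ (1 + K%:R^-1)) ^+ K <= _).
  by rewrite ltrXn2r // powR_ge0.
by rewrite -powR_mulrn ?powR_ge0 // -powRrM mulrDl mul1r mulVf // natr1 powR_mulrn.
Qed.
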